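(* For an integer $n\ge1$ and $0\le\lambda\le2$ let $P_n(\lambda)=n\lambda^{n-1}I_{1-\frac{\lambda^2}{4}}\left(\frac{n+1}{2},\frac12\right)$, which is a probability density function in $\lambda$, and let $P_\infty(\lambda)=\lim_{n\to\infty}P_n(\lambda)$. Then, as $n\to\infty$, $P_n(\lambda)$ tends to $0$ everywhere except at $\lambda=\sqrt2$, where it tends to $\infty$. Thus the limiting probability density function $P_\infty(\lambda)$ can be said to equal $\delta(\lambda-\sqrt2)$, where $\delta$ is the Dirac delta function.
   Context: For $a,b>0$ and $0\le x\le 1$, $I_x(a,b)$ is the regularized incomplete Beta function $$I_x(a,b)=\frac{\int_0^x t^{a-1}(1-t)^{b-1}\,dt}{\int_0^1 t^{a-1}(1-t)^{b-1}\,dt}.$$ *)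

(* Defs.v *)
From HB Require Import structures.
From mathcomp Require Import all_boot all_order all_algebra.
From mathcomp Require Import all_classical all_reals all_analysis.

Set Implicit Arguments.
Unset Strict Implicit.
Unset Printing Implicit Defensive.

Import Order.TTheory GRing.Theory Num.Theory.
Import numFieldNormedType.Exports.

Local Open Scope classical_set_scope.
Local Open Scope ring_scope.

(* The real exponents require powR. Since 0 `^ p = (p == 0)%:R, the integrand
   takes a junk value at an endpoint whose exponent is negative, which does not
   affect the integral. *)
Definition inc_beta (R : realType) (x a b : R) : R :=
  \int[lebesgue_measure]_(t in `[0, x]) (t `^ (a - 1) * (1 - t) `^ (b - 1)).

Definition reg_inc_beta (R : realType) (x a b : R) : R :=
  inc_beta x a b / inc_beta 1 a b.

(* Only meant for 1 <= n and 0 <= lam <= 2. *)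
Definition P (R : realType) (n : nat) (lam : R) : R :=
  n%:R * lam ^+ n.-1
  * reg_inc_beta (1 - lam ^+ 2 / 4%:R) ((n%:R + 1) / 2%:R) (2%:R)^-1.

(* The pointwise limit has to be taken in the extended reals. *)
Definition P_infty (R : realType) (lam : R) : \bar R :=
  limn (fun n => (P n lam)%:E).

Definition is_pdf_on (R : realType) (D : set R) (p : R -> R) : Prop :=
  [/\ measurable_fun D p,
      forall x, D x -> 0 <= p x &
      (\int[lebesgue_measure]_(x in D) (p x)%:E = 1)%E].

(* The measures p_n(x) dx on D converge weakly to m. This is how a limit of
   densities is said to equal a Dirac delta (m := \d_c), a pointwise limit
   carrying no such information. For bounded D no boundedness or support
   condition on the test function f is needed. *)
Definition densities_cvg_to (R : realType) (D : set R) (p : nat -> R -> R)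
    (m : {measure set R -> \bar R}) : Prop :=
  forall f : R -> R, continuous f ->
    (\int[lebesgue_measure]_(x in D) (f x * p n x)) @[n --> \oo]
      --> \int[m]_x f x.

(* Main.v *)
Require Import Defs.
From HB Require Import structures.
From mathcomp Require Import all_boot all_order all_algebra.
From mathcomp Require Import all_classical all_reals all_analysis.
From mathcomp Require Import measurable_realfun.
From mathcomp Require Import ring lra.
Import Order.TTheory GRing.Theory Num.Theory.
Import numFieldNormedType.Exports.
Local Open Scope classical_set_scope.
Local Open Scope ring_scope.

(** Write n = m + 1, h(s) = (1 - s^2)^(m/2), let H be a primitive of h and
W = H(1) - H(0). The substitution t = 1 - s^2 turns the incomplete Beta integral
with parameters (m+2)/2 and 1/2, which has a singular integrand at t = 1, into
an integral of the continuous function h: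
<<
    P_n(lam) = n lam^m (H(1) - H(lam/2)) / W        (0 <= lam <= 2)
>>
which is [P_slabE]. The theorem follows from elementary facts on h and H, chiefly on the duplication identity [slice_double],
h(1 - lam^2/2) = lam^m h(lam/2), a rewriting of
1 - (1 - lam^2/2)^2 = lam^2 (1 - (lam/2)^2).

- Total mass. By the duplication identity,
  lam^n (H(1) - H(lam/2)) - H(1 - lam^2/2) / 2 is a primitive of W P_n; its
  increment on [0, 2] is (H(1) - H(-1)) / 2 = W because h is even.

- Decay away from sqrt 2. As h is nonincreasing on [0, 1] and W >= 1/n,
  P_n(lam) <= n^2 lam^m h(lam/2) = n^2 h(1 - lam^2/2) ([P_upper]). The right-hand
  side is n^2 q^m with q = sqrt (1 - (1 - lam^2/2)^2), and q < 1 unless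
  lam = sqrt 2; moreover q is bounded away from 1 outside any neighbourhood of
  sqrt 2.

- Blow-up at sqrt 2. With c = 1 / sqrt 2, bounding the half circle
  sqrt (1 - s^2) from below by its chord over [c, 1] gives
  H(1) - H(c) >= h(c) (1 - c) / n, and sqrt(2)^m h(c) = 1, so that
  P_n(sqrt 2) >= (1 - c) / W ([P_lower]), while W tends to 0.

- Weak convergence. The P_n are probability densities that tend to 0
  uniformly on the complement of any neighbourhood of sqrt 2, hence they
  concentrate at that point ([P_cvg_dirac]). *)

(** * Comparison of increments and an improper fundamental theorem *)

Lemma le_increment (R : realType) (F G f g : R -> R) (a b : R) : a <= b ->
  (forall x, a <= x <= b -> is_derive x 1 F (f x)) ->
  (forall x, a <= x <= b -> is_derive x 1 G (g x)) ->
  (forall x, a <= x <= b -> f x <= g x) ->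
  F b - F a <= G b - G a.
Proof.
move=> ab dF dG fg; rewrite -subr_ge0.
have dD x : x \in `[a, b]%R -> is_derive x 1 (G - F) (g x - f x).
  by rewrite in_itv/= => xab; apply: is_deriveB; [exact: dG|exact: dF].
have cD : {within `[a, b], continuous (G - F)}.
  by apply: derivable_within_continuous => x /dD[].
have [x xab e] :=
  @MVT_segment R (G - F) _ a b ab (fun x xab => dD x (subset_itv_oo_cc xab)) cD.
have : 0 <= (G - F) b - (G - F) a.
  by move: xab; rewrite e in_itv/= => xab; rewrite mulr_ge0 ?subr_ge0// fg.
by rewrite !fctE; lra.
Qed.

(** The integrand may be unbounded near b: the ordinary theorem applies on the
intervals from a to u with u < b, and monotone convergence together with the continuity of F
at b gives the limit u --> b. *)
Lemma ge0_improper_FTC2 (R : realType) (f F : R -> R) (a b : R) : a < b ->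
  (forall x, a <= x < b -> 0 <= f x) ->
  (forall x, a < x < b -> {within `[a, x], continuous f}) ->
  {within `[a, b], continuous F} ->
  (forall x, a < x < b -> is_derive x 1 F (f x)) ->
  (\int[lebesgue_measure]_(x in `[a, b]) (f x)%:E = (F b - F a)%:E)%E.
Proof.
move=> ab f0 cf cF dF.
pose u (k : nat) : R := b - (b - a) / k.+2%:R.
have u_itv k : a < u k < b.
  rewrite /u ltrBrDl ltrBlDl ltrDr divr_gt0 ?subr_gt0// andbT.
  by rewrite -ltrBrDr ltr_pdivrMr// ltr_pMr ?subr_gt0// ltr1n.
have u_nd : nondecreasing_seq u.
  move=> i j ij; rewrite /u lerD2l lerN2 ler_wpM2l ?subr_ge0 ?(ltW ab)//.
  by rewrite lef_pV2 ?posrE// ler_nat !ltnS.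
have u_cvg : u k @[k --> \oo] --> b.
  rewrite -[X in _ --> X]subr0; apply: cvgB; first exact: cvg_cst.
  rewrite -(mulr0 (b - a)); apply: cvgM; first exact: cvg_cst.
  have := @cvg_harmonic R; rewrite -cvg_shiftS; exact.
have subk k : `[a, u k] `<=` `[a, b[.
  by have /andP[_ ?] := u_itv k; apply: subset_itvl; rewrite bnd_simp.
have UE : `[a, b[%classic = \bigcup_k `[a, u k]%classic.
  apply/seteqP; split => [x|x [k _]]; last exact: subk.
  rewrite /= in_itv/= => /andP[ax xb].
  have : \forall k \near \oo, x < u k by apply: (cvgr_gt b).
  move=> [k _ /(_ k (leqnn k)) xk]; exists k => //=.
  by rewrite in_itv/= ax ltW.
have mf k : measurable_fun `[a, u k] f.
  apply: subspace_continuous_measurable_fun => //.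
  exact: cf.
have intk k : (\int[lebesgue_measure]_(x in `[a, u k]) (f x)%:E
    = (F (u k) - F a)%:E)%E.
  have /andP[ak kb] := u_itv k.
  have dFk : {in `]a, u k[, forall x : R, is_derive x (1 : R) F (f x)}.
    move=> x; rewrite in_itv/= => /andP[ax xk]; apply: dF.
    by rewrite ax (lt_trans xk).
  have cFk : {within `[a, u k], continuous F}.
    by apply: continuous_subspaceW cF; apply: subset_itvl; rewrite bnd_simp ltW.
  rewrite (continuous_FTC2 (F := F)) ?EFinB//.
  - exact: cf.
  - have [_ ? ?] := (continuous_within_itvP _ ak).1 cFk.
    by split => // x /dFk[].
  - by move=> x /dFk[? e]; rewrite derive1E.
rewrite -integral_itv_bndo_bndc; last first.
  by apply/measurable_EFinP; rewrite UE; apply/measurable_fun_bigcup.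
rewrite UE.
have ic : (\int[lebesgue_measure]_(x in `[a, u k]) (f x)%:E)%E @[k --> \oo]
    --> (\int[lebesgue_measure]_(x in \bigcup_k `[a, u k]%classic) (f x)%:E)%E.
  apply: ge0_nondecreasing_set_cvg_integral => //.
  - move=> i j ij; rewrite subsetEset; apply: subset_itvl.
    by rewrite bnd_simp u_nd.
  - move=> k; apply/measurable_EFinP; exact: mf.
  - by move=> k x /subk /=; rewrite in_itv/= lee_fin; exact: f0.
rewrite -(cvg_lim _ ic)//; under eq_fun do rewrite intk.
apply/cvg_lim => //; apply: cvg_EFin; first exact: nearW.
have [_ _ Fb] := (continuous_within_itvP _ ab).1 cF.
apply: cvgB; last exact: cvg_cst.
move/cvg_at_leftP : Fb; apply; split => // k.
by have /andP[] := u_itv k.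
Qed.

(** * Slices and slabs of the unit ball *)

(** Up to a constant factor, the m-dimensional volume of the slice at height s of
the unit ball of dimension m + 1. The power of a square root, rather than a real
power of 1 - s^2, makes it continuous on the whole line for every m. *)
Definition slice {R : realType} (m : nat) (s : R) : R := Num.sqrt (1 - s ^+ 2) ^+ m.

(** The lower end - 2 only has to lie below - 1, so that this primitive of [slice]
is differentiable at every x with -1 <= x <= 1. *)
Definition slab {R : realType} (m : nat) (x : R) : R :=
  \int[lebesgue_measure]_(s in `[- 2%:R, x]) slice m s.

Section slab.
Variables (R : realType) (m : nat).
Implicit Types x s t a b c lam : R.
Local Notation h := (@slice R m).
Local Notation H := (@slab R m).
Local Notation W := (H 1 - H 0).

Lemma continuous_slice : continuous h.
Proof.
move=> s.
apply: (@continuous_comp _ _ _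
  (fun s : R => Num.sqrt (1 - s ^+ 2)) (fun y => y ^+ m));
  last exact: exprn_continuous.
apply: (@continuous_comp _ _ _ (fun s : R => 1 - s ^+ 2) Num.sqrt);
  last exact: sqrt_continuous.
by apply: cvgB; [exact: cvg_cst|exact: exprn_continuous].
Qed.

Lemma is_derive_slab x : - 2 < x -> is_derive x 1 H (h x).
Proof.
move=> x2.
have [||dH HE] := @continuous_FTC1_closed R h (- 2) x (x + 1) _ _ x2 (continuous_slice x).
- by rewrite ltrDl.
- apply: continuous_compact_integrable; first exact: segment_compact.
  exact/continuous_subspaceT/continuous_slice.
by apply: DeriveDef; [exact: dH|rewrite -derive1E HE].
Qed.

(** The derivative of H x + H (- x) vanishes because h is even. *)
Lemma slab_sym : H 1 - H 0 = H 0 - H (- 1).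
Proof.
have hE s : h (- s) = h s by rewrite /slice sqrrN.
pose G x := H x + H (- x).
have dG x : 0 <= x <= 1 -> is_derive x 1 G 0.
  move=> /andP[x0 x1].
  have dH : is_derive x 1 H (h x) by apply: is_derive_slab; lra.
  have dHN : is_derive (- x) 1 H (h x) by rewrite -hE; apply: is_derive_slab; lra.
  have := is_deriveD dH (is_derive1_comp dHN (is_deriveNid x 1)).
  by rewrite mulrN1 subrr.
have d0 x : 0 <= x <= 1 -> is_derive x 1 (cst 0 : R -> R) 0.
  by move=> _; exact: is_derive_cst.
have := @le_increment R G (cst 0) (cst 0) (cst 0) 0 1 ler01 dG d0 (fun _ _ => lexx 0).
have := @le_increment R (cst 0) G (cst 0) (cst 0) 0 1 ler01 d0 dG (fun _ _ => lexx 0).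
by rewrite /G /cst oppr0; lra.
Qed.

Lemma slice_ge0 s : 0 <= h s.
Proof. by rewrite exprn_ge0// sqrtr_ge0. Qed.

Lemma slice0 : h 0 = 1.
Proof. by rewrite /slice expr0n subr0 sqrtr1 expr1n. Qed.

Lemma slice_le s t : s ^+ 2 <= t ^+ 2 -> h t <= h s.
Proof.
by move=> st; rewrite lerXn2r ?nnegrE ?sqrtr_ge0// ler_wsqrtr// lerD2l lerN2.
Qed.

Lemma slab_upper a b : 0 <= a -> a <= b -> H b - H a <= h a * (b - a).
Proof.
move=> a0 ab.
have -> : h a * (b - a) = (h a \*: id) b - (h a \*: id) a.
  by rewrite /= mulrBr.
apply: (@le_increment R H (h a \*: id) h (fun=> h a) a b) => // x /andP[ax xb].
- by apply: is_derive_slab; lra.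
- rewrite -[X in is_derive _ _ _ X]mulr1; exact: is_deriveZ.
- by apply: slice_le; rewrite ler_sqr ?nnegrE//; lra.
Qed.

(** For c <= s <= 1 the concave function sqrt (1 - s^2) lies above its chord, which
is sqrt (1 - c^2) (1 - s) / (1 - c); integrate the m-th power of that chord. *)
Lemma slab_lower c : 0 <= c < 1 -> h c * (1 - c) / m.+1%:R <= H 1 - H c.
Proof.
move=> /andP[c0 c1]; have c1' : 1 - c != 0 by rewrite subr_eq0 gt_eqF.
pose q : R -> R := (1 - c)^-1 \*: (cst 1 - id).
have qE x : q x = (1 - x) / (1 - c) by rewrite mulrC.
pose G := (- (h c * (1 - c) / m.+1%:R)) \*: q ^+ m.+1.
have -> : h c * (1 - c) / m.+1%:R = G 1 - G c.
  rewrite /G /= !fctE/= !qE subrr mul0r expr0n/= scaler0 divff// expr1n.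
  by rewrite sub0r scaleNr opprK [RHS]mulr1.
apply: (@le_increment R G H (fun x => h c * (q x) ^+ m) h c 1) =>
  // [|x /andP[cx x1]|x /andP[cx x1]|x /andP[cx x1]]; first lra.
- have dq : is_derive x 1 q ((1 - c)^-1 *: (0 - 1)).
    exact: is_deriveZ.
  apply: is_derive_eq (is_deriveZ _ (is_deriveX m.+1 dq)) _.
  rewrite /GRing.scale/=; field.
  by rewrite c1' nat1r pnatr_eq0.
- by apply: is_derive_slab; lra.
rewrite /slice -exprMn lerXn2r// ?nnegrE ?sqrtr_ge0//.
  by rewrite qE mulr_ge0 ?sqrtr_ge0// divr_ge0; lra.
rewrite qE; have q0 : 0 <= (1 - x) / (1 - c) by rewrite divr_ge0; lra.
rewrite -[X in _ * X]ger0_norm// -sqrtr_sqr -sqrtrM; last by nra.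
rewrite ler_wsqrtr// expr_div_n mulrA ler_pdivrMr; last by nra.
suff : 0 <= 2 * (x - c) * (1 - x) * (1 - c) by nra.
by rewrite !mulr_ge0//; lra.
Qed.

(** [slab_lower] at c = 0, where h c = 1. *)
Lemma half_slab_ge : m.+1%:R^-1 <= W.
Proof.
apply: le_trans (@slab_lower 0 _); last by rewrite lexx ltr01.
by rewrite slice0 subr0 !mul1r.
Qed.

Lemma half_slab_gt0 : 0 < W.
Proof. by apply: lt_le_trans half_slab_ge; rewrite invr_gt0. Qed.

Lemma inv_half_slab_le : W^-1 <= m.+1%:R.
Proof. by rewrite invf_ple ?posrE ?half_slab_gt0// half_slab_ge. Qed.

(** * The incomplete Beta function as the volume of a slab *)

Lemma powR_half_nat (t : R) (k : nat) : 0 <= t -> t `^ (k%:R / 2) = Num.sqrt t ^+ k.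
Proof.
by move=> t0; rewrite -powR12_sqrt// -powR_mulrn ?powR_ge0// -powRrM mulrC.
Qed.

(** The substitution t = 1 - s^2, in the form of the primitive
- 2 H (sqrt (1 - t)) of the integrand. For s = 0 the integrand is singular at the
right end t = 1. *)
Lemma inc_betaE s : 0 <= s <= 1 ->
  inc_beta (1 - s ^+ 2) ((m.+1%:R + 1) / 2) 2^-1 = 2 * (H 1 - H s).
Proof.
move=> /andP[s0]; rewrite le_eqVlt => /predU1P[->|s1].
  by rewrite expr1n subrr subrr mulr0 /inc_beta set_itv1 Rintegral_set1.
have s21 : s ^+ 2 < 1 by rewrite expr_lt1.
have s20 : 0 <= s ^+ 2 by rewrite exprn_ge0.
pose f (t : R) := Num.sqrt t ^+ m * (Num.sqrt (1 - t))^-1.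
pose F (t : R) := - 2 * H (Num.sqrt (1 - t)).
have fE (t : R) : 0 <= t <= 1 ->
    t `^ ((m.+1%:R + 1) / 2 - 1) * (1 - t) `^ (2^-1 - 1) = f t.
  move=> /andP[t0 t1].
  have -> : (m.+1%:R + 1) / 2 - 1 = m%:R / 2 :> R by rewrite -natr1; field.
  have -> : 2^-1 - 1 = - 2^-1 :> R by field.
  by rewrite powR_half_nat// powRN powR12_sqrt// subr_ge0.
have dF (t : R) : 0 < t < 1 -> is_derive t 1 F (f t).
  move=> /andP[t0 t1].
  have d1 : is_derive (1 - t) 1 (@Num.sqrt R) (2 * Num.sqrt (1 - t))^-1.
    by apply: is_derive1_sqrt; rewrite subr_gt0.
  have d2 : is_derive t 1 (cst 1 - id : R -> R) (0 - 1) by exact: is_deriveB.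
  have d3 : is_derive (Num.sqrt (1 - t)) 1 H (h (Num.sqrt (1 - t))).
    by apply: is_derive_slab; rewrite (lt_le_trans _ (sqrtr_ge0 _))// oppr_lt0.
  have d4 := @is_derive1_comp R Num.sqrt (cst 1 - id) t _ _ d1 d2.
  have d5 := @is_derive1_comp R H (Num.sqrt \o (cst 1 - id)) t _ _ d3 d4.
  apply: is_derive_eq (is_deriveZ (- 2) d5) _.
  rewrite /f /slice sqr_sqrtr ?subr_ge0 ?(ltW t1)// subKr /GRing.scale/=.
  by field; rewrite sqrtr_eq0 -ltNge subr_gt0.
have cF : continuous F.
  move=> t; apply: cvgM; first exact: cvg_cst.
  apply: (@continuous_comp _ _ _ (fun t : R => Num.sqrt (1 - t)) H).
    apply: (@continuous_comp _ _ _ (fun t : R => 1 - t) Num.sqrt).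
      by apply: cvgB; [exact: cvg_cst|exact: cvg_id].
    exact: sqrt_continuous.
  apply/differentiable_continuous/derivable1_diffP.
  have [//] : is_derive (Num.sqrt (1 - t)) 1 H (h (Num.sqrt (1 - t))).
    by apply: is_derive_slab; rewrite (lt_le_trans _ (sqrtr_ge0 _))// oppr_lt0.
have cf (t : R) : t < 1 -> {for t, continuous f}.
  move=> t1; apply: cvgM.
    apply: (@continuous_comp _ _ _ Num.sqrt (fun y => y ^+ m)).
      exact: sqrt_continuous.
    exact: exprn_continuous.
  apply: cvgV; first by rewrite sqrtr_eq0 -ltNge subr_gt0.
  apply: (@continuous_comp _ _ _ (fun t : R => 1 - t) Num.sqrt).
    by apply: cvgB; [exact: cvg_cst|exact: cvg_id].
  exact: sqrt_continuous.
have x0 : 0 < 1 - s ^+ 2 by rewrite subr_gt0.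
rewrite /inc_beta /Rintegral.
under eq_integral => t.
  rewrite inE/= in_itv/= => /andP[t0 t1].
  rewrite fE; last by rewrite t0 (le_trans t1)// gerBl.
  over.
have -> : (\int[lebesgue_measure]_(t in `[0%R, (1 - s ^+ 2)%R]) (f t)%:E =
    (F (1 - s ^+ 2) - F 0)%R%:E)%E.
  apply: (@ge0_improper_FTC2 R f F).
  - exact: x0.
  - by move=> t _; rewrite mulr_ge0 ?invr_ge0 ?exprn_ge0 ?sqrtr_ge0.
  - move=> t /andP[t0 t1]; apply: continuous_in_subspaceT => z.
    by rewrite inE/= in_itv/= => /andP[z0 zt]; apply: cf; lra.
  - exact: continuous_subspaceT.
  - by move=> t /andP[t0 t1]; apply: dF; rewrite t0; lra.
rewrite /= /F subr0 sqrtr1 subKr sqrtr_sqr ger0_norm//; lra.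
Qed.

Definition Pslab lam : R := m.+1%:R * lam ^+ m * ((H 1 - H (lam / 2)) / W).

Lemma P_slabE lam : 0 <= lam <= 2 -> P m.+1 lam = Pslab lam.
Proof.
move=> /andP[l0 l2]; rewrite /P /Pslab /reg_inc_beta.
have -> : 1 - lam ^+ 2 / 4 = 1 - (lam / 2) ^+ 2 by field.
have B1 := @inc_betaE 0; rewrite expr0n/= subr0 lexx ler01 in B1.
rewrite inc_betaE; last by lra.
rewrite B1//; congr (_ * _).
by rewrite -mulf_div divff ?mul1r// pnatr_eq0.
Qed.

(** * Mass and pointwise bounds of the densities *)

Lemma slice_double lam : 0 <= lam ->
  h (1 - lam ^+ 2 / 2) = lam ^+ m * h (lam / 2).
Proof.
move=> l0; rewrite /slice -exprMn -[X in X * Num.sqrt _]ger0_norm// -sqrtr_sqr.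
by rewrite -sqrtrM ?sqr_ge0//; congr (Num.sqrt _ ^+ _); field.
Qed.

Lemma slab_le a b : 0 <= a -> a <= b -> b <= 1 -> H a <= H b.
Proof.
move=> a0 ab b1; rewrite -subr_ge0.
rewrite -(subrr (0 : R)).
apply: (@le_increment R (cst 0) H (cst 0) h a b ab).
- by move=> x /andP[ax xb]; apply: is_derive_slab; lra.
- by move=> x _; exact: slice_ge0.
Qed.

Lemma Pslab_ge0 lam : 0 <= lam <= 2 -> 0 <= Pslab lam.
Proof.
move=> /andP[l0 l2]; rewrite /Pslab !mulr_ge0 ?exprn_ge0//.
- by rewrite subr_ge0 slab_le//; lra.
- by rewrite invr_ge0 ltW// half_slab_gt0.
Qed.

Lemma is_derive_slab_half lam : 0 <= lam ->
  is_derive lam 1 (fun x => H (x / 2)) (h (lam / 2) / 2).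
Proof.
move=> l0.
have d1 : is_derive lam 1 (2^-1 \*: id : R -> R) (2^-1 *: 1) by exact: is_deriveZ.
have d2 : is_derive (2^-1 * lam) 1 H (h (lam / 2)).
  by rewrite mulrC; apply: is_derive_slab; lra.
have -> : (fun x => H (x / 2)) = H \o (2^-1 \*: id : R -> R).
  by apply/funext => x /=; rewrite /GRing.scale/= mulrC.
have := @is_derive1_comp R H (2^-1 \*: id) lam _ _ d2 d1.
by rewrite /GRing.scale/= mulr1.
Qed.

Lemma continuous_Pslab : {within `[0, 2], continuous Pslab}.
Proof.
apply: continuous_in_subspaceT => x; rewrite inE/= in_itv/= => /andP[x0 _].
have cH : {for x, continuous (fun y : R => H (y / 2))}.
  apply/differentiable_continuous/derivable1_diffP.
  by have [] := is_derive_slab_half x x0.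
apply: cvgM.
  by apply: cvgM; [exact: cvg_cst|exact: exprn_continuous].
apply: cvgM; last exact: cvg_cst.
by apply: cvgB; [exact: cvg_cst|exact: cH].
Qed.

(** Differentiating lam^(m+1) (H 1 - H (lam / 2)) produces, besides the integrand,
the term - lam^(m+1) h (lam / 2) / 2; by [slice_double] it is cancelled by the
derivative of - H (1 - lam^2 / 2) / 2. *)
Lemma integral_Pslab : (\int[lebesgue_measure]_(x in `[0%R, 2%R]) (Pslab x)%:E = 1)%E.
Proof.
have W0 : W != 0 by rewrite gt_eqF// half_slab_gt0.
pose F : R -> R := W^-1 \*: ((id ^+ m.+1) * (cst (H 1) - fun x => H (x / 2))
  - (2^-1 \*: (H \o (cst 1 - (2^-1 \*: id ^+ 2))))).
have FE x : F x = W^-1 * (x ^+ m.+1 * (H 1 - H (x / 2)) - 2^-1 * H (1 - 2^-1 * x ^+ 2)).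
  by rewrite /F !fctE/= /GRing.scale/=.
have dF x : 0 <= x <= 2 -> is_derive x 1 F (Pslab x).
  move=> /andP[x0 x2].
  have d1 := is_deriveX m.+1 (is_derive_id x (1 : R)).
  have d2 := is_deriveB (is_derive_cst (H 1) x (1 : R)) (is_derive_slab_half x x0).
  have d3 : is_derive x 1 (cst 1 - (2^-1 \*: id ^+ 2) : R -> R) (0 - 2^-1 *: ((2%:R * x ^+ 1) *: 1)).
    exact: is_deriveB.
  have d4 : is_derive (1 - 2^-1 * x ^+ 2) 1 H (x ^+ m * h (x / 2)).
    by rewrite -slice_double// mulrC; apply: is_derive_slab; nra.
  have d5 := @is_derive1_comp R H (cst 1 - (2^-1 \*: id ^+ 2)) x _ _ d4 d3.
  apply: is_derive_eq (is_deriveZ W^-1 (is_deriveB (is_deriveM d1 d2) (is_deriveZ 2^-1 d5))) _.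
  rewrite /Pslab /GRing.scale/= !fctE/= exprS.
  by field.
have cF : {within `[0, 2], continuous F}.
  apply: derivable_within_continuous => x; rewrite in_itv/= => x02.
  by have [] := dF x x02.
have -> : (1%E : \bar R) = (F 2 - F 0)%R%:E.
  rewrite !FE expr0n/= mul0r divff// subrr mulr0 expr0n/= mulr0 subr0.
  have -> : 1 - 2^-1 * 2 ^+ 2 = - 1 :> R by field.
  congr _%:E; have := slab_sym => e.
  apply: (mulfI W0); rewrite -mulrBr mulVKf//; lra.
apply: (@ge0_improper_FTC2 R Pslab F).
- by [].
- by move=> x /andP[x0 x2]; apply: Pslab_ge0; rewrite x0 ltW.
- move=> x /andP[x0 x2]; apply: continuous_subspaceW continuous_Pslab.
  by apply: subset_itvl; rewrite bnd_simp ltW.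
- exact: cF.
- by move=> x /andP[x0 x2]; apply: dF; rewrite !ltW.
Qed.

Lemma P_pdf : is_pdf_on `[0, 2] (@P R m.+1).
Proof.
split.
- apply: (@eq_measurable_fun _ _ _ _ _ Pslab).
    by move=> x; rewrite inE/= in_itv/= => x02; rewrite P_slabE.
  by apply: subspace_continuous_measurable_fun => //; exact: continuous_Pslab.
- by move=> x; rewrite /= in_itv/= => x02; rewrite P_slabE// Pslab_ge0.
- rewrite -integral_Pslab; apply: eq_integral => x; rewrite inE/= in_itv/= => x02.
  by rewrite P_slabE.
Qed.

(** In H 1 - H (lam / 2) the integrand is at most h (lam / 2), on an interval
of length at most 1, and W >= 1 / (m + 1). *)
Lemma P_upper lam : 0 <= lam <= 2 ->
  P m.+1 lam <= m.+1%:R ^+ 2 * slice m (1 - lam ^+ 2 / 2).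
Proof.
move=> /andP[l0 l2]; rewrite P_slabE ?l0// /Pslab slice_double//.
have /andP[l0' l1] : 0 <= lam / 2 <= 1 by lra.
rewrite expr2 -!mulrA ler_wpM2l// [leRHS]mulrCA ler_wpM2l ?exprn_ge0// [leRHS]mulrC.
rewrite ler_pM ?invr_ge0 ?(ltW half_slab_gt0) ?inv_half_slab_le ?subr_ge0 ?slab_le//.
apply: le_trans (@slab_upper _ _ _ _) _ => //.
by rewrite ler_piMr ?slice_ge0//; lra.
Qed.

(** [slab_lower] at c = 1 / sqrt 2, where (sqrt 2)^m h c = h 0 = 1. *)
Lemma P_lower : (1 - (Num.sqrt 2)^-1) / W <= P m.+1 (Num.sqrt 2 : R).
Proof.
have s2 : (Num.sqrt 2 : R) ^+ 2 = 2 by rewrite sqr_sqrtr.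
have s0 : 0 < (Num.sqrt 2 : R) by rewrite sqrtr_gt0.
have s1 : 1 < (Num.sqrt 2 : R) by nra.
have half : Num.sqrt 2 / 2 = (Num.sqrt 2)^-1 :> R.
  by rewrite -[X in _ / X]s2 expr2 invfM mulVKf ?gt_eqF// mulrA divff ?mul1r ?gt_eqF.
rewrite P_slabE; last by nra.
rewrite /Pslab half mulrA ler_wpM2r ?invr_ge0 ?(ltW half_slab_gt0)//.
have c1 : 0 <= (Num.sqrt 2 : R)^-1 < 1 by rewrite invr_ge0 ltW//= invf_lt1.
have := @slab_lower _ c1.
have hE : Num.sqrt 2 ^+ m * h (Num.sqrt 2)^-1 = 1.
  by rewrite -half -slice_double ?ltW// s2 divff// subrr slice0.
have m0 : 0 < m.+1%:R * Num.sqrt 2 ^+ m :> R by rewrite mulr_gt0 ?exprn_gt0.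
rewrite -(ler_pM2l m0); apply: le_trans.
set c := (Num.sqrt 2)^-1 in hE *.
have -> : m.+1%:R * Num.sqrt 2 ^+ m * (h c * (1 - c) / m.+1%:R) =
    Num.sqrt 2 ^+ m * h c * (1 - c) by field; rewrite nat1r pnatr_eq0.
by rewrite hE mul1r.
Qed.

(** Split at e: h is at most h 0 = 1 before it and at most h e after it. *)
Lemma half_slab_le (e : R) : 0 < e < 1 -> W <= e + slice m e.
Proof.
move=> /andP[e0 e1].
have := @slab_upper 0 e (lexx _) (ltW e0).
have := @slab_upper e 1 (ltW e0) (ltW e1).
rewrite slice0 mul1r subr0 => u1 u2.
have : h e * (1 - e) <= h e by rewrite ler_piMr ?slice_ge0//; lra.
lra.
Qed.

End slab.

(** * Limits *)

Section limits.
Variables (R : realType).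
Implicit Types q lam : R.

(** With q = r^4, the bound (m+1) r^m <= 1 + r + ... + r^m <= 1 / (1 - r) leaves
a geometric sequence of ratio r^2. *)
Lemma cvg_sqr_geometric q : 0 <= q < 1 ->
  m.+1%:R ^+ 2 * q ^+ m @[m --> \oo] --> (0 : R).
Proof.
move=> /andP[q0 q1]; pose p := Num.sqrt q; pose r := Num.sqrt p.
have p1 : p < 1 by rewrite -sqrtr1 ltr_sqrt.
have r1 : r < 1 by rewrite -sqrtr1 ltr_sqrt.
have r0 : 0 <= r := sqrtr_ge0 _.
have p0 : 0 <= p := sqrtr_ge0 _.
have nr m : m.+1%:R * r ^+ m <= (1 - r)^-1.
  rewrite -[leRHS]mul1r ler_pdivlMr ?subr_gt0//.
  apply: (@le_trans _ _ (1 - r ^+ m.+1)); last by rewrite gerBl exprn_ge0.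
  have -> : 1 - r ^+ m.+1 = (\sum_(i < m.+1) r ^+ i) * (1 - r).
    by rewrite -opprB subrX1 -mulNr opprB mulrC.
  rewrite ler_wpM2r ?subr_ge0 ?(ltW r1)//.
  rewrite mulr_natl -[X in _ *+ X]card_ord -sumr_const.
  by apply: ler_sum => i _; rewrite ler_wiXn2l ?(ltW r1)// -ltnS.
apply: (@squeeze_cvgr _ _ _ _ (cst 0) (geometric ((1 - r)^-1 ^+ 2) p)).
- apply: nearW => m /=; rewrite mulr_ge0 ?sqr_ge0 ?exprn_ge0//=.
  rewrite -(sqr_sqrtr q0) -/p expr2 exprMn mulrA ler_wpM2r ?exprn_ge0//.
  have -> : m.+1%:R ^+ 2 * p ^+ m = (m.+1%:R * r ^+ m) ^+ 2.
    by rewrite exprMn -exprM mulnC exprM sqr_sqrtr.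
  by rewrite ler_sqr ?nnegrE ?invr_ge0 ?subr_ge0 ?(ltW r1)// mulr_ge0 ?exprn_ge0.
- exact: cvg_cst.
- by apply: cvg_geometric; rewrite ger0_norm.
Qed.

Lemma sqrt_1Bsqr_lt1 (y : R) : y != 0 -> 0 <= Num.sqrt (1 - y ^+ 2) < 1.
Proof.
move=> y0; rewrite sqrtr_ge0/=.
by rewrite -[X in _ < X]sqrtr1 ltr_sqrt// gtrBl exprn_even_gt0.
Qed.

Lemma P_cvg0 lam : 0 <= lam <= 2 -> lam != Num.sqrt 2 -> P n lam @[n --> \oo] --> (0 : R).
Proof.
move=> l02 ls; have /andP[l0 l2] := l02; rewrite -cvg_shiftS /=.
have y0 : 1 - lam ^+ 2 / 2 != 0.
  apply: contra_neq ls => e; have -> : 2 = lam ^+ 2 by lra.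
  by rewrite sqrtr_sqr ger0_norm.
apply: (squeeze_cvgr _ _ (cvg_sqr_geometric _ (sqrt_1Bsqr_lt1 _ y0))); last exact: (cvg_cst 0).
apply: nearW => m; rewrite P_upper// andbT.
by rewrite P_slabE// Pslab_ge0.
Qed.

Lemma half_slab_cvg0 : (@slab R m 1 - slab m 0) @[m --> \oo] --> (0 : R).
Proof.
apply/cvgrPdist_le => e e0.
pose d := Num.min (e / 2) 2^-1.
have d0 : 0 < d by rewrite lt_min invr_gt0 divr_gt0//=.
have d1 : d < 1 by rewrite gt_min invf_lt1 ?ltr1n ?orbT.
have dn0 : d != 0 by rewrite gt_eqF.
have /andP[b0 b1] := sqrt_1Bsqr_lt1 _ dn0.
have : geometric 1 (Num.sqrt (1 - d ^+ 2)) n @[n --> \oo] --> (0:R).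
  by apply: cvg_geometric; rewrite ger0_norm.
move/cvgrPdist_le => /(_ d d0); apply: filterS => m /=.
rewrite !sub0r !normrN mul1r ger0_norm ?exprn_ge0// => hm.
rewrite gtr0_norm ?half_slab_gt0//.
apply: le_trans (half_slab_le _ _ d _) _; first by rewrite d0.
have : d <= e / 2 by rewrite ge_min lexx.
by rewrite /slice; lra.
Qed.

Lemma P_cvgy : P n (Num.sqrt 2 : R) @[n --> \oo] --> +oo.
Proof.
rewrite -cvg_shiftS /=.
have s1 : 0 < 1 - (Num.sqrt 2 : R)^-1.
  by rewrite subr_gt0 invf_lt1 ?sqrtr_gt0// -[X in X < _]sqrtr1 ltr_sqrt ?ltr1n.
apply: (ger_cvgy (f := fun m => (1 - (Num.sqrt 2)^-1) / (@slab R m 1 - slab m 0))).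
  by apply: nearW => m; exact: P_lower.
apply/gtr0_cvgV0; first by apply: nearW => m; rewrite divr_gt0 ?half_slab_gt0.
rewrite [X in X @ _ --> _](_ : _ =
    fun m => (slab m 1 - slab m 0) / (1 - (Num.sqrt 2)^-1)); last first.
  by apply/funext => m /=; rewrite -[LHS]/((_ / _)^-1) invf_div.
by rewrite -[X in _ --> X](mul0r (1 - (Num.sqrt 2)^-1)^-1); apply: cvgM;
  [exact: half_slab_cvg0|exact: cvg_cst].
Qed.

(** [P_upper] with |1 - lam^2/2| = |sqrt 2 - lam| (sqrt 2 + lam) / 2 >= d / 2. *)
Lemma P_uniform (m : nat) (d lam : R) : 0 <= lam <= 2 -> 0 <= d ->
  d <= `|Num.sqrt 2 - lam| -> P m.+1 lam <= m.+1%:R ^+ 2 * slice m (d / 2).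
Proof.
move=> l02 d0 dl; apply: le_trans (P_upper _ _ _ l02) _.
rewrite ler_wpM2l ?sqr_ge0// slice_le//.
have s2 : (Num.sqrt 2 : R) ^+ 2 = 2 by rewrite sqr_sqrtr.
have s0 : 0 <= (Num.sqrt 2 : R) by rewrite sqrtr_ge0.
have d2 : d ^+ 2 <= (Num.sqrt 2 - lam) ^+ 2.
  by rewrite -[leRHS]real_normK ?num_real// ler_sqr ?nnegrE.
have -> : 1 - lam ^+ 2 / 2 = (Num.sqrt 2 - lam) * (Num.sqrt 2 + lam) / 2.
  by rewrite -subr_sqr s2; field.
have l2 : 2 <= (Num.sqrt 2 + lam) ^+ 2.
  by rewrite -[leLHS]s2 ler_sqr ?nnegrE; lra.
rewrite expr_div_n [leRHS]expr_div_n ler_wpM2r// exprMn.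
have : 0 <= (Num.sqrt 2 - lam) ^+ 2 by exact: sqr_ge0.
nra.
Qed.

(** Write c for sqrt 2. As P_n has mass 1, the error is at most the integral of
|f c - f| P_n. Where lam is close to c the integrand is at most (e / 2) P_n by
continuity of f; elsewhere it is at most M K, with M the maximum of |f c - f| and
K a uniform bound of P_n that tends to 0. *)
Lemma P_cvg_dirac : densities_cvg_to `[0, 2] (@P R) (\d_(Num.sqrt 2 : R)).
Proof.
move=> f cf; set c : R := Num.sqrt 2.
have -> : \int[\d_c]_x f x = f c.
  rewrite /Rintegral integral_dirac ?diracT ?mul1e//.
  apply/measurable_EFinP; exact: continuous_measurable_fun.
rewrite -cvg_shiftS /=; apply/cvgrPdist_le => e e0.
pose D : set R := `[0, 2]%classic.
have mD : measurable D by exact: measurable_itv.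
have DE (g : R -> R) : {within D, continuous g} ->
    lebesgue_measure.-integrable D (EFin \o g).
  by move=> cg; apply: continuous_compact_integrable => //; exact: segment_compact.
have cD (g : R -> R) : continuous g -> {within D, continuous g}.
  exact: continuous_subspaceT.
have cg : continuous (fun x => `|f c - f x|).
  by move=> x; apply: cvg_norm; apply: cvgB; [exact: cvg_cst|exact: cf].
have [x0 _ x0P] := EVT_max (ler0n R 2) (cD _ cg).
set M := `|f c - f x0| in x0P.
have M0 : 0 <= M := normr_ge0 _.
have [d /= d0 fd] : exists2 d : R, 0 < d & forall x, `|c - x| < d -> `|f c - f x| <= e / 2.
  have /cvgrPdist_le/(_ (e / 2)) := cf c; rewrite divr_gt0// => /(_ isT).
  by move=> [d /= d0 fd]; exists d.
have dn0 : d / 2 != 0 by rewrite gt_eqF// divr_gt0.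
have := cvg_sqr_geometric _ (sqrt_1Bsqr_lt1 _ dn0).
(* With this bound on K the constant M K integrates to 2 M K <= e / 2. *)
move/cvgrPdist_le => /(_ (e / (4 * (M + 1)))); rewrite divr_gt0; [|lra..] => /(_ isT).
apply: filterS => m; rewrite sub0r normrN.
set K : R := m.+1%:R ^+ 2 * slice m (d / 2).
rewrite -[X in `|X|]/K.
have K0 : 0 <= K by rewrite mulr_ge0 ?sqr_ge0 ?slice_ge0.
rewrite ger0_norm// ler_pdivlMr; last lra.
move=> hK.
pose Q := @Pslab R m.
have cQ : {within D, continuous Q} := @continuous_Pslab R m.
have Q1 : \int[lebesgue_measure]_(x in D) Q x = 1.
  by rewrite /Rintegral integral_Pslab.
have -> : \int[lebesgue_measure]_(x in `[0, 2]) (f x * P m.+1 x) =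
    \int[lebesgue_measure]_(x in D) (f x * Q x).
  by apply: eq_Rintegral => x; rewrite inE/= in_itv/= => x02; rewrite P_slabE.
have cMQ (g : R -> R) : continuous g -> {within D, continuous (fun x => g x * Q x)}.
  by move=> /cD cg' x; apply: cvgM; [exact: cg'|exact: cQ].
rewrite -[f c in X in X <= _]mulr1 -Q1 -RintegralZl//; last exact: DE.
rewrite -RintegralB//; [|by apply/DE/cMQ => ?; exact: cvg_cst|by apply/DE/cMQ].
have -> : \int[lebesgue_measure]_(x in D) (f c * Q x - f x * Q x) =
    \int[lebesgue_measure]_(x in D) ((f c - f x) * Q x).
  by apply: eq_Rintegral => x _; rewrite mulrBl.
have ig : lebesgue_measure.-integrable D (EFin \o (fun x => (f c - f x) * Q x)).
  by apply/DE/cMQ => x; apply: cvgB; [exact: cvg_cst|exact: cf].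
apply: le_trans (le_normr_Rintegral _ ig) _ => //.
have QD x : D x -> 0 <= Q x.
  by rewrite /D/= in_itv/= => x02; exact: Pslab_ge0.
have -> : \int[lebesgue_measure]_(x in D) `|(f c - f x) * Q x| =
    \int[lebesgue_measure]_(x in D) (`|f c - f x| * Q x).
  by apply: eq_Rintegral => x /set_mem /QD Q0; rewrite normrM (ger0_norm Q0).
have cR : {within D, continuous (fun x => e / 2 * Q x + M * K)}.
  have cE := cMQ (cst (e / 2)) (fun _ => cvg_cst _).
  by move=> x; apply: cvgD; [exact: cE|exact: cvg_cst].
have iQ : lebesgue_measure.-integrable D (EFin \o (fun x => e / 2 * Q x)).
  by apply/DE/cMQ => ?; exact: cvg_cst.
have iK : lebesgue_measure.-integrable D (EFin \o (fun _ : R => M * K)).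
  by apply/DE/cD => ?; exact: cvg_cst.
apply: (@le_trans _ _ (\int[lebesgue_measure]_(x in D) (e / 2 * Q x + M * K))).
  apply: le_Rintegral => //.
  - exact: (DE _ (cMQ _ cg)).
  - exact: DE.
  - move=> x Dx; have x02 : 0 <= x <= 2 by move: Dx; rewrite /D/= in_itv.
    have Q0 := QD x Dx.
    have MK0 : 0 <= M * K by rewrite mulr_ge0.
    have [xd|dx] := ltP `|c - x| d.
      by apply: (@le_trans _ _ (e / 2 * Q x)); rewrite ?ler_wpM2r ?fd ?lerDl.
    apply: (@le_trans _ _ (M * K)); last by rewrite lerDr mulr_ge0// ltW// divr_gt0.
    apply: ler_pM => //; first by apply: x0P; rewrite in_itv.
    have -> : Q x = P m.+1 x by rewrite P_slabE.
    exact: (P_uniform _ _ _ x02 (ltW d0) dx).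
rewrite RintegralD//.
rewrite RintegralZl ?Q1//; last exact: DE.
have -> : \int[lebesgue_measure]_(x in D) (M * K) = M * K * 2.
  rewrite Rintegral_cst//; congr (_ * _).
  have := lebesgue_measure_itv `[0 : R, 2].
  by rewrite /= lte_fin ltr0n/= oppr0 adde0 => /(congr1 fine).
nra.
Qed.

End limits.

Theorem mainTheorem3 (R : realType) :
  [/\ forall n : nat, (1 <= n)%N -> is_pdf_on `[0, 2%:R] (@P R n),
      forall lam : R, 0 <= lam <= 2%:R -> lam != Num.sqrt 2%:R ->
        P n lam @[n --> \oo] --> (0 : R) /\ P_infty lam = 0%E,
      P n (Num.sqrt 2%:R : R) @[n --> \oo] --> +oo /\
        P_infty (Num.sqrt 2%:R : R) = +oo%E &
      densities_cvg_to `[0, 2%:R] (@P R) (\d_(Num.sqrt 2%:R : R))].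
Proof.
split.
- by case=> [//|m] _; exact: P_pdf.
- move=> lam l02 ls; have c0 := P_cvg0 R lam l02 ls; split=> //.
  by apply/cvg_lim => //; apply: cvg_EFin => //; exact: nearW.
- have cy := P_cvgy R; split=> //.
  by apply/cvg_lim => //; exact/cvgeryP.
- exact: P_cvg_dirac.
Qed.
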